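(* Let $X$ be a biquandle, let $R$ be a commutative ring with unity, and let $(A,B)$ be an $X$-bracket with values in $R$. Then for any $x,y\in X$ we have (i) $A_{x,x}=A_{x\underline{\triangleright}y,\,x\underline{\triangleright}y}=A_{x\overline{\triangleright}y,\,x\overline{\triangleright}y}$, and (ii) $B_{x,x}=B_{x\underline{\triangleright}y,\,x\underline{\triangleright}y}=B_{x\overline{\triangleright}y,\,x\overline{\triangleright}y}$.
   Context: A biquandle is a set $X$ with two binary operations $\underline{\triangleright},\overline{\triangleright}$ such that for all $x,y,z\in X$: (i) $x\,\underline{\triangleright}\,x = x\,\overline{\triangleright}\,x$; (ii) the maps $\alpha_y:X\to X$, $\alpha_y(x)=x\,\overline{\triangleright}\,y$, $\beta_y:X\to X$, $\beta_y(x)=x\,\underline{\triangleright}\,y$, and $S:X\times X\to X\times X$, $S(x,y)=(y\,\overline{\triangleright}\,x,\ x\,\underline{\triangleright}\,y)$, are invertible; (iii) the exchange laws hold: $(x\,\underline{\triangleright}\,y)\,\underline{\triangleright}\,(z\,\underline{\triangleright}\,y)=(x\,\underline{\triangleright}\,z)\,\underline{\triangleright}\,(y\,\overline{\triangleright}\,z)$, $(x\,\underline{\triangleright}\,y)\,\overline{\triangleright}\,(z\,\underline{\triangleright}\,y)=(x\,\overline{\triangleright}\,z)\,\underline{\triangleright}\,(y\,\overline{\triangleright}\,z)$, $(x\,\overline{\triangleright}\,y)\,\overline{\triangleright}\,(z\,\overline{\triangleright}\,y)=(x\,\overline{\triangleright}\,z)\,\overline{\triangleright}\,(y\,\underline{\triangleright}\,z)$.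 Let $R$ be a commutative ring with unity, with unit group $R^\times$. A biquandle bracket on $X$ with values in $R$, also called an $X$-bracket, is a pair of maps $A,B:X\times X\to R^\times$ (written $A_{x,y}$, $B_{x,y}$) together with elements $\delta\in R$ and $w\in R^\times$ such that: (i) for all $x\in X$, $\delta A_{x,x}+B_{x,x}=w$ and $\delta A_{x,x}^{-1}+B_{x,x}^{-1}=w^{-1}$; (ii) for all $x,y\in X$, $\delta=-A_{x,y}B_{x,y}^{-1}-A_{x,y}^{-1}B_{x,y}$; (iii) for all $x,y,z\in X$: $A_{x,y}A_{y,z}A_{x\underline{\triangleright}y,\,z\overline{\triangleright}y}=A_{x,z}A_{y\overline{\triangleright}x,\,z\overline{\triangleright}x}A_{x\underline{\triangleright}z,\,y\underline{\triangleright}z}$, $A_{x,y}B_{y,z}B_{x\underline{\triangleright}y,\,z\overline{\triangleright}y}=B_{x,z}B_{y\overline{\triangleright}x,\,z\overline{\triangleright}x}A_{x\underline{\triangleright}z,\,y\underline{\triangleright}z}$, $B_{x,y}A_{y,z}B_{x\underline{\triangleright}y,\,z\overline{\triangleright}y}=B_{x,z}A_{y\overline{\triangleright}x,\,z\overline{\triangleright}x}B_{x\underline{\triangleright}z,\,y\underline{\triangleright}z}$, $A_{x,y}A_{y,z}B_{x\underline{\triangleright}y,\,z\overline{\triangleright}y}=A_{x,z}B_{y\overline{\triangleright}x,\,z\overline{\triangleright}x}A_{x\underline{\triangleright}z,\,y\underline{\triangleright}z}+A_{x,z}A_{y\overline{\triangleright}x,\,z\overline{\triangleright}x}B_{x\underline{\triangleright}z,\,y\underline{\triangleright}z}+\delta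 A_{x,z}B_{y\overline{\triangleright}x,\,z\overline{\triangleright}x}B_{x\underline{\triangleright}z,\,y\underline{\triangleright}z}+B_{x,z}B_{y\overline{\triangleright}x,\,z\overline{\triangleright}x}B_{x\underline{\triangleright}z,\,y\underline{\triangleright}z}$, $B_{x,z}A_{y\overline{\triangleright}x,\,z\overline{\triangleright}x}A_{x\underline{\triangleright}z,\,y\underline{\triangleright}z}=B_{x,y}A_{y,z}A_{x\underline{\triangleright}y,\,z\overline{\triangleright}y}+A_{x,y}B_{y,z}A_{x\underline{\triangleright}y,\,z\overline{\triangleright}y}+\delta B_{x,y}B_{y,z}A_{x\underline{\triangleright}y,\,z\overline{\triangleright}y}+B_{x,y}B_{y,z}B_{x\underline{\triangleright}y,\,z\overline{\triangleright}y}$. Since $\delta$ and $w$ are determined by $A$ and $B$, the bracket is denoted simply $(A,B)$; a pair $(A,B)$ is called an $X$-bracket if there exist such $\delta,w$. *)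

(* Defs.v *)
From mathcomp Require Import all_boot all_algebra.

Set Implicit Arguments.
Unset Strict Implicit.
Unset Printing Implicit Defensive.

Import GRing.Theory.
Local Open Scope ring_scope.

Reserved Notation "A @[ x , y ]"
  (at level 1, left associativity, format "A @[ x ,  y ]").
Reserved Notation "x |>_ y" (at level 40, left associativity).
Reserved Notation "x |>^ y" (at level 40, left associativity).

Record biquandle := Biquandle {
  carrier :> Type;
  under : carrier -> carrier -> carrier;
  over : carrier -> carrier -> carrier;
  under_over_diag : forall x, under x x = over x x;
  over_bij : forall y, bijective (fun x => over x y);
  under_bij : forall y, bijective (fun x => under x y);
  switch_bij :
    bijective (fun p : carrier * carrier => (over p.2 p.1, under p.1 p.2));
  exchange1 : forall x y z,
    under (under x y) (under z y) = under (under x z) (over y z);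
  exchange2 : forall x y z,
    over (under x y) (under z y) = under (over x z) (over y z);
  exchange3 : forall x y z,
    over (over x y) (over z y) = over (over x z) (under y z)
}.

Notation "x |>_ y" := (under x y).
Notation "x |>^ y" := (over x y).

(* The unit group of R.  The library attaches inverses only to nontrivial rings
   (unitRingType); a unit is packaged here with its inverse so that the zero
   ring is allowed as well. *)
Record units (R : comPzRingType) := Unit {
  uval : R;
  uinv : R;
  uvalK : uval * uinv = 1
}.

Notation "A @[ x , y ]" := (uval (A x y)).

Record bracket_axioms (X : biquandle) (R : comPzRingType)
    (A B : X -> X -> units R) (delta : R) (w : units R) : Prop := {
  bracket_w : forall x, delta * A@[x, x] + B@[x, x] = uval w;
  bracket_w_inv : forall x, delta * uinv (A x x) + uinv (B x x) = uinv w;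
  bracket_delta : forall x y,
    delta = - (A@[x, y] * uinv (B x y)) - uinv (A x y) * B@[x, y];
  bracket_AAA : forall x y z,
    A@[x, y] * A@[y, z] * A@[x |>_ y, z |>^ y]
    = A@[x, z] * A@[y |>^ x, z |>^ x] * A@[x |>_ z, y |>_ z];
  bracket_ABB : forall x y z,
    A@[x, y] * B@[y, z] * B@[x |>_ y, z |>^ y]
    = B@[x, z] * B@[y |>^ x, z |>^ x] * A@[x |>_ z, y |>_ z];
  bracket_BAB : forall x y z,
    B@[x, y] * A@[y, z] * B@[x |>_ y, z |>^ y]
    = B@[x, z] * A@[y |>^ x, z |>^ x] * B@[x |>_ z, y |>_ z];
  bracket_AAB : forall x y z,
    A@[x, y] * A@[y, z] * B@[x |>_ y, z |>^ y]
    = A@[x, z] * B@[y |>^ x, z |>^ x] * A@[x |>_ z, y |>_ z]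
      + A@[x, z] * A@[y |>^ x, z |>^ x] * B@[x |>_ z, y |>_ z]
      + delta * A@[x, z] * B@[y |>^ x, z |>^ x] * B@[x |>_ z, y |>_ z]
      + B@[x, z] * B@[y |>^ x, z |>^ x] * B@[x |>_ z, y |>_ z];
  bracket_BAA : forall x y z,
    B@[x, z] * A@[y |>^ x, z |>^ x] * A@[x |>_ z, y |>_ z]
    = B@[x, y] * A@[y, z] * A@[x |>_ y, z |>^ y]
      + A@[x, y] * B@[y, z] * A@[x |>_ y, z |>^ y]
      + delta * B@[x, y] * B@[y, z] * A@[x |>_ y, z |>^ y]
      + B@[x, y] * B@[y, z] * B@[x |>_ y, z |>^ y]
}.

Definition is_bracket (X : biquandle) (R : comPzRingType)
    (A B : X -> X -> units R) : Prop :=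
  exists (delta : R) (w : units R), bracket_axioms A B delta w.

(* Main.v *)
Require Import Defs.
From mathcomp Require Import all_boot all_algebra.
Import GRing.Theory.
Local Open Scope ring_scope.

(** The purely [A] exchange relation, taken at a triple with two equal adjacent
    entries, involves a single diagonal value of [A] on each side.  At (x, x, y)
    the remaining factors agree because [x |>_ x = x |>^ x], and they are units;
    cancelling them shows that the diagonal of [A] is invariant under [|>_]
    ([diagA_under]).  The triple (y, x, x) gives invariance under [|>^]
    ([diagA_over]).  The writhe relation [delta * A@[x, x] + B@[x, x] = w]
    expresses each diagonal value of [B] through that of [A] by a formula that
    is the same for all [x], so the diagonal of [B] inherits the invariance
    ([diagB_eq]). *)

Lemma uval_mulIr {R : comPzRingType} (u : units R) {a b : R} :
  a * uval u = b * uval u -> a = b.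
Proof.
by move=> e; rewrite -[a]mulr1 -[b]mulr1 -(uvalK u) !mulrA e.
Qed.

Lemma diagA_under {X : biquandle} {R : comPzRingType}
    {A B : X -> X -> units R} {delta : R} {w : units R}
    (bracketAB : bracket_axioms A B delta w) x y :
  A@[x |>_ y, x |>_ y] = A@[x, x].
Proof.
have e := bracket_AAA bracketAB x x y.
apply: (uval_mulIr (A x y)); apply: (uval_mulIr (A (x |>^ x) (y |>^ x))).
by rewrite -{2}under_over_diag e mulrAC [RHS]mulrAC mulrC mulrA mulrAC.
Qed.

Lemma diagA_over {X : biquandle} {R : comPzRingType}
    {A B : X -> X -> units R} {delta : R} {w : units R}
    (bracketAB : bracket_axioms A B delta w) x y :
  A@[x |>^ y, x |>^ y] = A@[x, x].
Proof.
have e := bracket_AAA bracketAB y x x.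
apply: (uval_mulIr (A y x)); apply: (uval_mulIr (A (y |>_ x) (x |>_ x))).
by rewrite ![_ * A@[y, x]]mulrC -e under_over_diag.
Qed.

Lemma diagB_eq {X : biquandle} {R : comPzRingType}
    {A B : X -> X -> units R} {delta : R} {w : units R}
    (bracketAB : bracket_axioms A B delta w) x y :
  A@[x, x] = A@[y, y] -> B@[x, x] = B@[y, y].
Proof.
move=> eA; apply: (addrI (delta * A@[x, x])).
by rewrite (bracket_w bracketAB) eA (bracket_w bracketAB).
Qed.

Theorem theorem3 (X : biquandle) (R : comPzRingType)
    (A B : X -> X -> units R) (hAB : is_bracket A B) (x y : X) :
  (A@[x, x] = A@[x |>_ y, x |>_ y]
   /\ A@[x |>_ y, x |>_ y] = A@[x |>^ y, x |>^ y])
  /\ (B@[x, x] = B@[x |>_ y, x |>_ y]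
      /\ B@[x |>_ y, x |>_ y] = B@[x |>^ y, x |>^ y]).
Proof.
have [delta [w bAB]] := hAB.
have eU := diagA_under bAB x y; have eO := diagA_over bAB x y.
by split; split; try apply: (diagB_eq bAB); rewrite ?eU ?eO.
Qed.
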